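(* If a graph $G$ admits a near $\alpha$-valuation, then for every positive integer $l$ the lexicographic product $G\cdot K_l^c$ admits a near $\alpha$-valuation.
   Context: $K_l^c$ is the edgeless graph on $l$ vertices. The lexicographic product $G\cdot H$ has vertex set $V(G)\times V(H)$, with $(x,y)$ adjacent to $(u,v)$ iff $\{x,u\}\in E(G)$, or $x=u$ and $\{y,v\}\in E(H)$; thus $G\cdot K_l^c$ replaces each vertex of $G$ by $l$ independent vertices, joined completely to the copies of its neighbours. A $\beta$-valuation of a graph with $n$ edges is an injective $b:V\to\{0,\ldots,n\}$ such that the multiset of $|b(u)-b(v)|$ over edges $\{u,v\}$ is $\{1,\ldots,n\}$. A near $\alpha$-valuation is a $\beta$-valuation with a partition $V=V_{small}\cup V_{large}$ such that every vertex of $V_{small}$ has label smaller than all its neighbours' labels and every vertex of $V_{large}$ has label larger than all its neighbours' labels. *)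

(* Defs.v *)
From mathcomp Require Import all_boot ssralg ssrnum ssrint.
Set Implicit Arguments.
Unset Strict Implicit.
Unset Printing Implicit Defensive.

(* Finite simple graphs. *)
Record sgraph := SGraph {
  vertex :> finType;
  adj : rel vertex;
  adj_sym : symmetric adj;
  adj_irrefl : irreflexive adj }.

Definition edges (G : sgraph) : {set {set G}} :=
  [set [set p.1; p.2] | p : G * G & adj p.1 p.2].

Section Edgeless.
Variable l : nat.

Definition edgeless_adj : rel 'I_l := fun _ _ => false.

Fact edgeless_sym : symmetric edgeless_adj.
Proof. by []. Qed.

Fact edgeless_irrefl : irreflexive edgeless_adj.
Proof. by []. Qed.

Definition edgeless : sgraph := SGraph edgeless_sym edgeless_irrefl.

End Edgeless.

Section LexProduct.
Variables G H : sgraph.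

Definition lex_adj : rel (G * H)%type := fun p q =>
  adj p.1 q.1 || (p.1 == q.1) && adj p.2 q.2.

Fact lex_sym : symmetric lex_adj.
Proof.
by move=> p q; rewrite /lex_adj adj_sym eq_sym [adj p.2 q.2]adj_sym.
Qed.

Fact lex_irrefl : irreflexive lex_adj.
Proof. by move=> p; rewrite /lex_adj !adj_irrefl andbF. Qed.

Definition lex_prod : sgraph := SGraph lex_sym lex_irrefl.

End LexProduct.

(* An edge being an unordered pair, its label |b u - b v| is obtained as a     *)
(* maximum over its endpoints; see edge_label2.                               *)
Definition edge_label (T : finType) (b : T -> nat) (A : {set T}) : nat :=
  \max_(u in A) \max_(v in A) `|b u - b v|%N.

Lemma edge_label2 (T : finType) (b : T -> nat) (u v : T) :
  edge_label b [set u; v] = `|b u - b v|%N.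
Proof.
apply/eqP; rewrite eqn_leq; apply/andP; split.
  apply/bigmax_leqP => x /set2P xuv; apply/bigmax_leqP => y /set2P yuv.
  by case: xuv yuv => -> [] ->; rewrite ?distnn ?leqnn // distnC leqnn.
by apply: (bigmax_sup u); rewrite ?set21 //; apply: (bigmax_sup v); rewrite ?set22.
Qed.

Definition beta_valuation (G : sgraph) (b : G -> nat) : Prop :=
  [/\ injective b,
      forall v, b v <= #|edges G|
    & perm_eq [seq edge_label b A | A <- enum (edges G)]
              (iota 1 #|edges G|)].

(* The two classes of the partition are nonempty, as usual for partitions.    *)
(* This is automatic as soon as G has an edge; it excludes the one-vertex     *)
(* graph, whose product with an edgeless graph on l > 1 vertices has no edge  *)
(* and l vertices, hence no injective labelling by {0}.                       *)
Definition near_alpha_valuation (G : sgraph) (b : G -> nat) : Prop :=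
  beta_valuation b /\
  exists Vsmall Vlarge : {set G},
    [/\ Vsmall != set0 /\ Vlarge != set0,
        Vsmall :|: Vlarge = [set: G],
        [disjoint Vsmall & Vlarge],
        forall u v, u \in Vsmall -> adj u v -> b u < b v
      & forall u v, u \in Vlarge -> adj u v -> b v < b u].

Definition has_near_alpha_valuation (G : sgraph) : Prop :=
  exists b : G -> nat, near_alpha_valuation b.

(* Main.v *)
Require Import Defs.
From mathcomp Require Import all_boot.
From mathcomp Require Import ssrint zify.

(** Orient every edge from its small to its large end. If [b] is a near
    alpha-valuation, relabel the copies [(u, i)], [i < l], of a small vertex [u]
    by [b u * l^2 + i], and those of a large vertex [v] by [b v * l^2 - l * j].
    An edge of [G] with label [d] then gives [l^2] edges with labels
    [d * l^2 - (j * l + i)], which fill the interval from [(d - 1) * l^2 + 1] to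
    [d * l^2] exactly once. The new labels stay in range because the ends of the
    edge with the largest label [n] carry [0] and [n]: no large vertex is
    labelled [0] and no small vertex is labelled [n]. *)

Set Implicit Arguments.
Unset Strict Implicit.
Unset Printing Implicit Defensive.

(** * Uniqueness of digits in a fixed base *)

Lemma eq_digits m q r q' r' : r < m -> r' < m ->
  q * m + r = q' * m + r' -> q = q' /\ r = r'.
Proof.
by move=> rm r'm E; have := edivn_eq q rm; rewrite E edivn_eq // => -[-> ->].
Qed.

(** Since [d] is positive, no truncation occurs, and [d * m - r - 1] has base-[m] digits [d - 1] and
    [m - r - 1]. *)
Lemma eq_codigits m d r d' r' : r < m -> r' < m -> 0 < d -> 0 < d' ->
  d * m - r = d' * m - r' -> d = d' /\ r = r'.
Proof.
case: d d' => [//|d] [//|d'] rm r'm _ _; rewrite !mulSn => E.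
have := @eq_digits m d (m - r.+1) d' (m - r'.+1); lia.
Qed.

Lemma digits_lt l i j : i < l -> j < l -> j * l + i < l * l.
Proof. nia. Qed.

(** * Edges of a bipartite graph as arcs *)

Section Arcs.
Variables (G : sgraph) (S : {set G}).

Definition arcs : {set G * G} := [set p | (p.1 \in S) && adj p.1 p.2].

Lemma in_arcs u v : ((u, v) \in arcs) = (u \in S) && adj u v.
Proof. by rewrite inE. Qed.

Hypothesis bipS : forall u v, adj u v -> (v \in S) = (u \notin S).

Definition edge_of_arc (p : G * G) : {set G} := [set p.1; p.2].

(** The tail of an arc is the only end of its edge that lies in [S]. *)
Lemma edge_of_arc_inj : {in arcs &, injective edge_of_arc}.
Proof.
move=> [u v] [u' v']; rewrite !inE /= => /andP[uS uv] /andP[u'S u'v'] E.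
have vS : v \notin S by rewrite (bipS uv) uS.
have v'S : v' \notin S by rewrite (bipS u'v') u'S.
have := set21 u v; have := set22 u v; rewrite [[set u; v]]E.
case/set2P => [ev|->]; first by rewrite ev u'S in vS.
by case/set2P => [->|eu] //; rewrite eu (negPf v'S) in uS.
Qed.

Lemma edges_arcs : edges G = edge_of_arc @: arcs.
Proof.
apply/setP => A; apply/imsetP/imsetP => -[[u v]]; last first.
  by rewrite inE => /andP[_ uv] ->; exists (u, v); rewrite ?inE.
rewrite inE /= => uv ->; case uS: (u \in S).
  by exists (u, v); rewrite ?inE ?uS.
exists (v, u); last by rewrite /edge_of_arc /= setUC.
by rewrite inE /= (bipS uv) uS adj_sym.
Qed.

Lemma card_edges_arcs : #|edges G| = #|arcs|.
Proof. by rewrite edges_arcs card_in_imset //; exact: edge_of_arc_inj. Qed.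

(** This trades absolute values over unordered pairs for plain differences over arcs. *)
Lemma edge_labels_arcs (b : G -> nat) :
  (forall u v, u \in S -> adj u v -> b u < b v) ->
  perm_eq [seq edge_label b A | A <- enum (edges G)]
          [seq b p.2 - b p.1 | p <- enum arcs].
Proof.
move=> ltb; have E : [seq b p.2 - b p.1 | p <- enum arcs] =
    [seq edge_label b A | A <- map edge_of_arc (enum arcs)].
  rewrite -map_comp; apply/eq_in_map => -[u v].
  rewrite mem_enum inE /= => /andP[uS uv].
  by rewrite edge_label2 distnEr // ltnW // ltb.
rewrite E; apply: perm_map; apply: uniq_perm.
- exact: enum_uniq.
- rewrite map_inj_in_uniq ?enum_uniq // => p q.
  by rewrite !mem_enum; apply: edge_of_arc_inj.
- move=> A; rewrite mem_enum edges_arcs; apply/imsetP/mapP.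
    by case=> p pD ->; exists p; rewrite ?mem_enum.
  by case=> p; rewrite mem_enum => pD ->; exists p.
Qed.

End Arcs.

(** * The blown-up labelling *)

Section Blowup.
Variables (G : sgraph) (b : G -> nat) (S : {set G}) (l : nat).
Hypothesis l_gt0 : 0 < l.
Hypothesis inj_b : injective b.
Hypothesis bipS : forall u v, adj u v -> (v \in S) = (u \notin S).
Hypothesis ltb : forall u v, u \in S -> adj u v -> b u < b v.
Hypothesis labels_b :
  perm_eq [seq edge_label b A | A <- enum (edges G)] (iota 1 #|edges G|).
Hypothesis le_b : forall u, b u <= #|edges G|.
Hypothesis small_lt : forall u, u \in S -> b u < #|edges G|.
Hypothesis large_gt0 : forall u, u \notin S -> 0 < b u.

Let GL := lex_prod G (edgeless l).

Definition blowup_label (p : GL) : nat :=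
  if p.1 \in S then b p.1 * (l * l) + (p.2 : 'I_l)
  else b p.1 * (l * l) - (p.2 : 'I_l) * l.

Definition blowup_set : {set GL} := [set p | p.1 \in S].

Lemma lex_edgeless_adj (p q : GL) : adj p q = adj p.1 q.1.
Proof. by rewrite /= /lex_adj /= andbF orbF. Qed.

Lemma blowup_label_inj : injective blowup_label.
Proof.
(* Adding [j * l] to both sides leaves the remainder [j * l + i], below [l * l], on the left and 0
   on the right; hence [b u = b v], although [u] and [v] lie on different sides. *)
have mixed (u v : G) (i j : 'I_l) : u \in S -> v \notin S ->
    b u * (l * l) + i = b v * (l * l) - j * l -> False.
  move=> uS vS E; have ji := digits_lt (ltn_ord i) (ltn_ord j).
  have bv := large_gt0 vS.
  have E' : b u * (l * l) + (j * l + i) = b v * (l * l) + 0 by nia.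
  have [/inj_b uv _] := eq_digits ji (leq_ltn_trans (leq0n _) ji) E'.
  by rewrite uv (negPf vS) in uS.
move=> [u i] [v j]; rewrite /blowup_label /=; case: ifPn => uS; case: ifPn => vS.
- have [il jl] : i < l * l /\ j < l * l.
    by have := ltn_ord i; have := ltn_ord j; split; nia.
  by case/eq_digits => // /inj_b -> /val_inj ->.
- by move/(mixed _ _ _ _ uS vS).
- by move/esym/(mixed _ _ _ _ vS uS).
- have [il jl] : i * l < l * l /\ j * l < l * l.
    by have := ltn_ord i; have := ltn_ord j; split; nia.
  case/eq_codigits => //; try exact: large_gt0.
  by move=> /inj_b -> /eqP; rewrite eqn_pmul2r // => /eqP/val_inj ->.
Qed.

Lemma blowup_bip (p q : GL) :
  adj p q -> (q \in blowup_set) = (p \notin blowup_set).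
Proof. by rewrite lex_edgeless_adj !inE => /bipS. Qed.

(** The two shifts merge into one number with base-[l] digits the two copy indices, so it determines
    both. *)
Lemma blowup_label_diff (p q : GL) : p \in blowup_set -> adj p q ->
  blowup_label q - blowup_label p =
  (b q.1 - b p.1) * (l * l) - ((q.2 : 'I_l) * l + (p.2 : 'I_l)).
Proof.
rewrite inE lex_edgeless_adj => pS pq; rewrite /blowup_label pS (bipS pq) pS /=.
by rewrite mulnBl; lia.
Qed.

Lemma blowup_label_lt (p q : GL) : p \in blowup_set -> adj p q ->
  blowup_label p < blowup_label q.
Proof.
move=> pS pq; rewrite -subn_gt0 blowup_label_diff //.
move: pS pq; rewrite inE lex_edgeless_adj => pS pq.
have := digits_lt (ltn_ord (p.2 : 'I_l)) (ltn_ord (q.2 : 'I_l)).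
have := ltb pS pq; nia.
Qed.

Lemma card_blowup_edges : #|edges GL| = #|edges G| * (l * l).
Proof.
rewrite (card_edges_arcs blowup_bip) (card_edges_arcs bipS).
(* An arc of the product is an arc of [G] with a choice of copy at each end. *)
pose f (x : (G * G) * ('I_l * 'I_l)) : GL * GL :=
  ((x.1.1, x.2.1), (x.1.2, x.2.2)).
have -> : arcs blowup_set = f @: setX (arcs S) setT.
  apply/setP => -[[u i] [v j]]; apply/idP/imsetP.
    rewrite !inE lex_edgeless_adj /= => uv.
    by exists ((u, v), (i, j)); rewrite ?inE ?uv.
  case=> -[[u' v'] [i' j']]; rewrite !inE /= => uv [-> _ -> _].
  by move: uv; rewrite /lex_adj andbT => /andP[-> ->].
rewrite card_imset; last by move=> [[u v] [i j]] [[u' v'] [i' j']] [-> -> -> ->].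
by rewrite cardsX cardsT card_prod !card_ord.
Qed.

Lemma blowup_beta : beta_valuation blowup_label.
Proof.
have labels_arcs := edge_labels_arcs bipS ltb.
rewrite perm_sym in labels_arcs.
have {}labels_arcs := perm_trans labels_arcs labels_b.
have diff_inj : {in arcs S &, injective (fun p => b p.2 - b p.1)}.
  apply/dinjectiveP; rewrite /dinjectiveb (perm_uniq labels_arcs).
  exact: iota_uniq.
split; first exact: blowup_label_inj.
  move=> [u i]; rewrite card_blowup_edges /blowup_label /=.
  (* A small label is below [#|edges G|], which leaves a full block of length [l * l] for the shift
     by [i]. *)
  case: ifP => [/small_lt ltu|_].
    apply: leq_trans (leq_mul ltu (leqnn (l * l))).
    rewrite mulSn addnC leq_add2r ltnW //.
    exact: leq_trans (ltn_ord i) (leq_pmulr _ _).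
  by apply: leq_trans (leq_subr _ _) _; rewrite leq_mul.
apply: perm_trans (edge_labels_arcs blowup_bip blowup_label_lt) _.
(* Equal labels give equal differences in [G], hence the same arc by [diff_inj]; the base-[l] digits
   then give the same copies. *)
have uniq_diffs :
    uniq [seq blowup_label p.2 - blowup_label p.1 | p <- enum (arcs blowup_set)].
  apply/dinjectiveP => -[p q] [p' q']; rewrite !in_arcs => /andP[pS pq].
  move=> /andP[p'S p'q'] /=; rewrite !blowup_label_diff //.
  move: pS pq p'S p'q'; rewrite !in_set !lex_edgeless_adj.
  case: p q p' q' => [u i] [v j] [u' i'] [v' j'] /= uS uv u'S u'v'.
  case/eq_codigits; rewrite ?subn_gt0; try exact: ltb; try exact: digits_lt.
  move=> /(diff_inj (u, v) (u', v')); rewrite !inE uS uv u'S u'v'.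
  move=> /(_ isT isT)[-> ->].
  by move=> /(eq_digits (ltn_ord i) (ltn_ord i'))[/ord_inj -> /ord_inj ->].
have sub_diffs : {subset [seq blowup_label p.2 - blowup_label p.1 |
    p <- enum (arcs blowup_set)] <= iota 1 #|edges GL|}.
  move=> x /mapP[[p q]]; rewrite mem_enum in_arcs => /andP[pS pq] ->.
  rewrite mem_iota subn_gt0 blowup_label_lt //= blowup_label_diff //.
  rewrite card_blowup_edges add1n ltnS.
  apply: leq_trans (leq_subr _ _) _; rewrite leq_mul2r; apply/orP; right.
  exact: leq_trans (leq_subr _ _) (le_b _).
apply: uniq_perm => //; first exact: iota_uniq.
(* Distinct labels within the interval, as many as it has elements, must fill it. *)
have [|_ //] := uniq_min_size uniq_diffs sub_diffs.
by rewrite size_iota size_map -cardE (card_edges_arcs blowup_bip).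
Qed.

End Blowup.

(* Two distinct labels force [G] to have an edge; the ends of the edge labelled
   [#|edges G|] carry [0] and [#|edges G|]. *)
Lemma near_alpha_extremes (G : sgraph) (b : G -> nat) (S : {set G}) :
  beta_valuation b ->
  (forall u v, adj u v -> (v \in S) = (u \notin S)) ->
  (forall u v, u \in S -> adj u v -> b u < b v) ->
  S != set0 -> ~: S != set0 ->
  (forall u, u \in S -> b u < #|edges G|) /\ (forall u, u \notin S -> 0 < b u).
Proof.
move=> [inj_b le_b labels_b] bipS ltb /set0Pn[x xS] /set0Pn[y]; rewrite inE => yS.
have n_gt0 : 0 < #|edges G|.
  rewrite lt0n; apply: contra yS => /eqP n0.
  have /inj_b <- // : b x = b y.
  by have := le_b x; have := le_b y; rewrite n0 !leqn0 => /eqP-> /eqP->.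
have : #|edges G| \in [seq b p.2 - b p.1 | p <- enum (arcs S)].
  rewrite -(perm_mem (edge_labels_arcs bipS ltb)) (perm_mem labels_b).
  by rewrite mem_iota n_gt0 add1n ltnS leqnn.
case/mapP => -[u v]; rewrite mem_enum inE /= => /andP[uS uv] n_uv.
have vS : v \notin S by rewrite (bipS _ _ uv) uS.
have [bu bv] : b u = 0 /\ b v = #|edges G|.
  by move: (le_b v) n_gt0; rewrite n_uv; lia.
(* By injectivity only [v] carries the top label and only [u] carries 0, and they lie outside and
   inside [S]. *)
split=> w wS; [rewrite ltn_neqAle le_b andbT|rewrite lt0n];
  [apply: contra vS|apply: contra wS] => /eqP bw.
  by rewrite (inj_b v w) // bv.
by rewrite (inj_b w u) // bu.
Qed.

Theorem theorem4p4 (G : sgraph) (HG : has_near_alpha_valuation G)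
    (l : nat) (Hl : 0 < l) :
  has_near_alpha_valuation (lex_prod G (edgeless l)).
Proof.
have [b [beta_b [S [L [[S0 L0] SUL SL ltS ltL]]]]] := HG.
have defL u : (u \in L) = (u \notin S).
  have /setP/(_ u) := SUL; rewrite !inE; case: (boolP (u \in S)) => //= uS _.
  by rewrite (disjointFr SL).
(* Two neighbours in the same class would each have to be labelled below the other. *)
have bipS u v : adj u v -> (v \in S) = (u \notin S).
  move=> uv; have vu : adj v u by rewrite adj_sym.
  case: (boolP (u \in S)) (boolP (v \in S)) => uS [] vS //.
    by have := ltS _ _ uS uv; have := ltS _ _ vS vu; lia.
  rewrite -!defL in uS vS.
  by have := ltL _ _ uS uv; have := ltL _ _ vS vu; lia.
have S0' : ~: S != set0.
  by case/set0Pn: L0 => w; rewrite defL => wS; apply/set0Pn; exists w; rewrite inE.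
have [small_lt large_gt0] := near_alpha_extremes beta_b bipS ltS S0 S0'.
have [inj_b le_b labels_b] := beta_b.
exists (blowup_label b S (l := l)); split; first exact: blowup_beta.
exists (blowup_set S l), (~: blowup_set S l); split.
- split; apply/set0Pn.
    by case/set0Pn: S0 => u uS; exists (u, Ordinal Hl); rewrite inE.
  by case/set0Pn: S0' => u uS; exists (u, Ordinal Hl); rewrite !inE in uS *.
- exact: setUCr.
- by rewrite -setI_eq0 setICr.
- by move=> p q; apply: blowup_label_lt.
- move=> p q; rewrite inE => pS pq; apply: blowup_label_lt => //.
    by rewrite (blowup_bip bipS pq).
  by rewrite adj_sym.
Qed.
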